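(* Let $G$ and $H$ be groups, let $A$ be a finite set with $|A|\ge 2$, and let $\phi : H \to G$ be a group homomorphism. A $\phi$-cellular automaton $\tau : A^G \to A^H$ is invertible if and only if it is bijective.
   Context: For a group $G$, $A^G$ is the set of all functions $x : G \to A$, with the shift action $(g\cdot x)(h) := x(g^{-1}h)$ for $x \in A^G$, $g,h\in G$. For groups $G,H$ and a group homomorphism $\phi : H \to G$, a function $\tau : A^G \to A^H$ is a $\phi$-cellular automaton if there are a finite subset $S \subseteq G$ and a function $\mu : A^S \to A$ such that $\tau(x)(h) = \mu((\phi(h^{-1})\cdot x)|_S)$ for all $x \in A^G$, $h \in H$. A $\phi$-cellular automaton $\tau : A^G \to A^H$ is invertible if there exist a group homomorphism $\psi : G \to H$ and a $\psi$-cellular automaton $\sigma : A^H \to A^G$ such that $\tau\circ\sigma = \mathrm{id}_{A^H}$ and $\sigma\circ\tau = \mathrm{id}_{A^G}$. *)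

(* Defs.v *)
From HB Require Import structures.
From mathcomp Require Export all_boot.
From mathcomp Require Export finmap.

Set Implicit Arguments.
Unset Strict Implicit.
Unset Printing Implicit Defensive.

Local Open Scope group_scope.

Section Configurations.
Context {G : groupType} {A : finType}.

Definition shift (g : G) (x : G -> A) : G -> A := fun h => x (g^-1 * h).

Definition restrict (S : {fset G}) (x : G -> A) : {ffun S -> A} :=
  [ffun s : S => x (val s)].

End Configurations.

(* Between groups, preserving products entails preserving 1 and inverses, so
   {multiplicative H -> G} is the type of group homomorphisms. *)
Definition cellular_automaton {G H : groupType} {A : finType}
    (phi : {multiplicative H -> G}) (tau : (G -> A) -> (H -> A)) : Prop :=
  exists (S : {fset G}) (mu : {ffun S -> A} -> A),
    forall (x : G -> A) (h : H),
      tau x h = mu (restrict S (shift (phi h^-1) x)).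

Definition ca_invertible {G H : groupType} {A : finType}
    (tau : (G -> A) -> (H -> A)) : Prop :=
  exists (psi : {multiplicative G -> H}) (sigma : (H -> A) -> (G -> A)),
    [/\ cellular_automaton psi sigma,
        tau \o sigma = id
      & sigma \o tau = id].

(* Main.v *)
From HB Require Import structures.
Require Import Defs.
From mathcomp Require Import boolp classical_sets filter.

(** The substance is that a bijective [phi]-cellular automaton [tau] is
    invertible.  There are two points.

    First, [phi] is an isomorphism, because [tau] intertwines the shift by
    [phi h] on [G -> A] with the shift by [h] on [H -> A].  If [phi h = phi h']
    then [h] and [h'] shift every configuration of the form [tau x] alike, and
    these are all the configurations over [H]; as [A] has two elements this
    forces [h = h'] ([phi_injective]).  For surjectivity, compare the
    configurations fixed by [H] on both sides: over [H] they are the constants,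
    and [tau] sends the constants over [G] injectively, hence (as [A] is finite)
    bijectively, onto them.  So [tau] leaves no room for another configuration
    over [G] that is invariant under [phi(H)]; but the indicator of [phi(H)]
    would be one if [phi(H)] were proper ([phi_surjective]).

    Second, [tau^-1] is a cellular automaton over [phi^-1].  It intertwines the
    shifts because [tau] does, so by the Curtis-Hedlund argument
    ([equivariant_local_cellular]) it suffices that each coordinate of
    [tau^-1 y] is determined by finitely many coordinates of [y].  This is
    compactness of [A^G] ([inverse_finitely_determined]), used here in the form
    of limits of configurations along an ultrafilter, since [G] may be
    uncountable. *)

Set Implicit Arguments.
Unset Strict Implicit.
Unset Printing Implicit Defensive.

Local Open Scope classical_set_scope.
Local Open Scope group_scope.

(** An ultrafilter finer than this one contains, for each point [q], the family
    of the finite sets containing [q]; this is what forces equality at every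
    coordinate of a limit taken over finite windows. *)
Lemma fset_tails_proper (Y : choiceType) :
  ProperFilter
    (filter_from setT (fun T0 : {fset Y} => [set T : {fset Y} | fsubset T0 T])).
Proof.
apply: filter_from_proper => [|T0 _]; last by exists T0; exact: fsubset_refl.
apply: filter_from_filter => [|T1 T2 _ _]; first by exists fset0.
by exists (fsetU T1 T2) => // T /=; rewrite fsubUset => /andP[].
Qed.

(** In an ultrafilter one block of any finite partition is large, so a
    finite-valued function has a limit. *)
Lemma ultra_finite_limit (I : Type) (A : finType) (U : set_system I)
    (UU : UltraFilter U) (f : I -> A) :
  exists a, U [set i | f i = a].
Proof.
apply: contrapT => /forallNP nolim.
have : U [set i | forall a, f i <> a].
  apply: filter_forall => a.
  by case: (in_ultra_setVsetC [set i | f i = a] UU) => // /nolim.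
by move=> /filter_ex [i /(_ (f i))].
Qed.

(** Pointwise limits of configurations along an ultrafilter exist: this is the
    compactness of the product [A^X]. *)
Lemma ultra_config_limit (I X : Type) (A : finType) (U : set_system I)
    (UU : UltraFilter U) (x : I -> X -> A) :
  exists l : X -> A, forall p, U [set i | x i p = l p].
Proof.
have [l xl] := boolp.choice (fun p => ultra_finite_limit UU (x ^~ p)).
by exists l.
Qed.

(** Continuity for the prodiscrete topologies on [A^X] and [A^Y]; as [A^X] is
    compact, the finite set can be chosen uniformly in the configuration. *)
Definition finitely_determined (X Y : choiceType) (A : Type)
    (F : (X -> A) -> (Y -> A)) : Prop :=
  forall q, exists S : {fset X},
    forall x x' : X -> A, (forall s, s \in S -> x s = x' s) -> F x q = F x' q.

Lemma finitely_determined_limit (I : Type) (X Y : choiceType) (A : finType)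
    (F : (X -> A) -> (Y -> A)) (U : set_system I) (FU : Filter U)
    (x : I -> X -> A) (l : X -> A) :
  finitely_determined F -> (forall p, U [set i | x i p = l p]) ->
  forall q, U [set i | F (x i) q = F l q].
Proof.
move=> Fdet xl q; have [S detS] := Fdet q.
apply: filterS (filter_bigI FU (D := S) (fun s _ => xl s)) => i /= xi.
exact: detS.
Qed.

(** The continuous inverse theorem for compact spaces.  If no finite set [T]
    of coordinates of [F x] determined the coordinate [p] of [x], each [T]
    would come with a pair of configurations differing at [p] whose images
    agree on [T]; limits of these pairs along an ultrafilter of larger and
    larger [T] would differ at [p] and yet have equal images. *)
Lemma inverse_finitely_determined (X Y : choiceType) (A : finType)
    (F : (X -> A) -> (Y -> A)) (K : (Y -> A) -> (X -> A)) :
  finitely_determined F -> cancel F K -> cancel K F -> finitely_determined K.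
Proof.
move=> Fdet FK KF p; apply: contrapT => /forallNP nodet.
have bad (T : {fset Y}) : exists xx : (X -> A) * (X -> A),
    (forall t, t \in T -> F xx.1 t = F xx.2 t) /\ xx.1 p <> xx.2 p.
  have /existsNP [y /existsNP [y' /not_implyP [yT yp]]] := nodet T.
  by exists (K y, K y'); split=> [t tT|//]; rewrite /= !KF; exact: yT.
have {bad} [xx xxP] := boolp.choice bad.
have [U [UU tailsU]] := ultraFilterLemma (fset_tails_proper Y).
have [l xl] := ultra_config_limit UU (fun T => (xx T).1).
have [l' xl'] := ultra_config_limit UU (fun T => (xx T).2).
have eqF : F l = F l'.
  apply/funext => q.
  have Uq : U [set T | fsubset [fset q]%fset T].
    by apply: tailsU; exists [fset q]%fset.
  have [T [[/= FT FT'] qT]] := filter_ex (filterI (filterI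
    (finitely_determined_limit _ Fdet xl q)
    (finitely_determined_limit _ Fdet xl' q)) Uq).
  rewrite -FT -FT'; apply: (xxP T).1.
  by rewrite -fsub1set.
have [T [/= lT lT']] := filter_ex (filterI (xl p) (xl' p)).
by apply: (xxP T).2; rewrite lT lT' -(FK l) eqF FK.
Qed.

Lemma shiftM (G : groupType) (A : finType) (g h : G) (x : G -> A) :
  shift g (shift h x) = shift (g * h) x.
Proof. by apply/funext => k; rewrite /shift invgM mulgA. Qed.

Lemma shift_invariant_const (G : groupType) (A : finType) (x : G -> A) :
  (forall g, shift g x = x) -> x = fun=> x 1.
Proof. by move=> xinv; apply/funext => k; rewrite -{1}(xinv k) /shift mulVg. Qed.

Definition equivariant (G H : groupType) (A : finType) (phi : H -> G)
    (tau : (G -> A) -> (H -> A)) : Prop :=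
  forall h x, tau (shift (phi h) x) = shift h (tau x).

Lemma cellular_equivariant (G H : groupType) (A : finType)
    (phi : {multiplicative H -> G}) (tau : (G -> A) -> (H -> A)) :
  cellular_automaton phi tau -> equivariant phi tau.
Proof.
move=> [S [mu tauE]] h x; apply/funext => k.
by rewrite {2}/shift !tauE shiftM -gmulfM invgM invgK.
Qed.

Lemma cellular_finitely_determined (G H : groupType) (A : finType)
    (phi : {multiplicative H -> G}) (tau : (G -> A) -> (H -> A)) :
  cellular_automaton phi tau -> finitely_determined tau.
Proof.
move=> [S [mu tauE]] h; exists [fset (phi h^-1)^-1 * s | s in S]%fset.
move=> x x' xx'; rewrite !tauE; congr mu; apply/ffunP => s.
by rewrite !ffunE; apply: xx'; apply/imfsetP; exists (val s) => //; exact: valP.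
Qed.

(** The Curtis-Hedlund argument: equivariance reduces every coordinate of
    [tau x] to the coordinate at [1], and the window that determines the latter
    serves as memory set. *)
Lemma equivariant_local_cellular (G H : groupType) (A : finType) (a : A)
    (phi : {multiplicative H -> G}) (tau : (G -> A) -> (H -> A)) :
  equivariant phi tau -> finitely_determined tau -> cellular_automaton phi tau.
Proof.
move=> tau_equiv /(_ 1) [S detS].
(* A pattern on the window is extended by the arbitrary value [a] outside it. *)
pose extend (f : {ffun S -> A}) (g : G) := if insub g is Some s then f s else a.
exists S, (fun f => tau (extend f) 1) => x h.
transitivity (tau (shift (phi h^-1) x) 1).
  by rewrite tau_equiv /shift invgK mulg1.
by apply: detS => s sS; rewrite /extend insubT ffunE.
Qed.

Section BijectiveEquivariant.
Variables (G H : groupType) (A : finType) (phi : {multiplicative H -> G}).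
Variables (tau : (G -> A) -> (H -> A)) (sigma : (H -> A) -> (G -> A)).
Hypothesis tau_equiv : equivariant phi tau.
Hypotheses (tauK : cancel tau sigma) (sigmaK : cancel sigma tau).
Variables a b : A.
Hypothesis neq_ab : a <> b.

Lemma phi_injective : injective phi.
Proof.
move=> h h' phihh'.
have same_shift (y : H -> A) : shift h y = shift h' y.
  by rewrite -(sigmaK y) -!tau_equiv phihh'.
(* Two shifts of the indicator of [1] that agree at the coordinate [h] have the
   same centre. *)
have := congr1 (@^~ h) (same_shift (fun k => if k == 1 then a else b)).
rewrite /shift mulVg eqxx; case: eqP => // h'h _.
by rewrite -(mulVKg h' h) h'h mulg1.
Qed.

(** A pigeonhole count: through [tau], the constants over [G] already exhaust
    the [#|A|] constants over [H], and these are the only configurations that an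
    [H]-invariant one can be sent to. *)
Lemma invariant_config_const (x : G -> A) :
  (forall h, shift (phi h) x = x) -> exists c, x = fun=> c.
Proof.
have tau_const z : (forall h, shift (phi h) z = z) -> tau z = fun=> tau z 1.
  by move=> zinv; apply: shift_invariant_const => h; rewrite -tau_equiv zinv.
pose m (c : A) := tau (fun=> c) 1.
have tau_cst c : tau (fun=> c) = fun=> m c by exact: tau_const.
have m_inj : injective m.
  move=> c d mcd; have : tau (fun=> c) = tau (fun=> d) by rewrite !tau_cst mcd.
  by move/(can_inj tauK)/(congr1 (@^~ 1)).
have [m' _ mK] := injF_bij m_inj.
move=> /tau_const tau_x; exists (m' (tau x 1)).
by apply: (can_inj tauK); rewrite tau_cst mK -tau_x.
Qed.

(** If some [g] were outside [phi(H)], the indicator of [phi(H)] would be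
    invariant under [phi(H)] without being constant. *)
Lemma phi_surjective (g : G) : exists h, phi h = g.
Proof.
pose x (k : G) := if `[< exists h, phi h = k >] then a else b.
have [h|c xc] := @invariant_config_const x.
  apply/funext => k; rewrite /shift /x; congr (if _ then _ else _).
  apply/asbool_equiv_eq; split=> -[h' h'k].
    by exists (h * h'); rewrite gmulfM h'k mulVKg.
  by exists (h^-1 * h'); rewrite -(mulKg (phi h) (phi _)) -gmulfM mulVKg h'k.
have x_image : x (phi 1) = a by rewrite /x asboolT //; exists 1.
apply: contrapT => ng; apply: neq_ab.
have x_g : x g = b by rewrite /x asboolF.
by rewrite -x_image -x_g xc.
Qed.

End BijectiveEquivariant.

Theorem theorem3 (G H : groupType) (A : finType) (hA : 1 < #|A|)
    (phi : {multiplicative H -> G}) (tau : (G -> A) -> (H -> A))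
    (htau : cellular_automaton phi tau) :
  ca_invertible tau <-> bijective tau.
Proof.
split=> [[_ [sigma [_ tausigma sigmatau]]]|[sigma tauK sigmaK]].
  exists sigma => z; first by rewrite -[RHS]/(id z) -sigmatau.
  by rewrite -[RHS]/(id z) -tausigma.
have [a [b [_ _ /eqP neq_ab]]] := card_gt1P hA.
have tau_equiv := cellular_equivariant htau.
have phi_inj := phi_injective tau_equiv sigmaK neq_ab.
have [psi psiK] := boolp.choice (phi_surjective tau_equiv tauK neq_ab).
have phiK : cancel phi psi by move=> h; apply: phi_inj; rewrite psiK.
pose psiM := isMultiplicative.Build G H psi (can2_gmulfM phiK psiK).
pose psi_mul : {multiplicative G -> H} := HB.pack psi psiM.
exists psi_mul, sigma; split; last 2 first.
- exact/funext.
- exact/funext.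
apply: (equivariant_local_cellular a) => [g y|].
  by apply: (can_inj tauK); rewrite -{2}(psiK g) tau_equiv !sigmaK.
have tau_det := cellular_finitely_determined htau.
exact: inverse_finitely_determined tau_det tauK sigmaK.
Qed.
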